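(* Let $0<\alpha\le\beta$ with $\alpha\le1$, and let $\gamma:[0,1]\to\mathbb{R}^n$ be an $(\alpha,\beta)$-bi-Hölder curve with constant $1\le C_\gamma<\infty$. Then there exist $C=C(\alpha,\beta,C_\gamma,n)>0$ and $r_0=r_0(\beta,C_\gamma)>0$ such that for all $0<r<r_0$, $$\frac1C\, r^{\frac{\beta-1}{\beta}}\le \Lambda(B(\widehat\gamma,r),r)\le C\, r^{\frac{\alpha-1}{\alpha}}.$$
   Context: A map $\gamma:[0,1]\to\mathbb{R}^n$ is an $(\alpha,\beta)$-bi-Hölder curve with constant $C_\gamma\ge1$ if $\frac1{C_\gamma}|x-y|^\beta\le|\gamma(x)-\gamma(y)|\le C_\gamma|x-y|^\alpha$ for all $x,y\in[0,1]$. $\widehat\gamma:=\gamma([0,1])$. For $A\subset\mathbb{R}^n$, $B(A,r):=\{x:\mathrm{dist}(x,A)\le r\}$. A rectifiable curve is the image of a Lipschitz map $[0,1]\to\mathbb{R}^n$. $\Lambda(E,r):=\inf\{\mathcal{H}^1(\Gamma):\Gamma \text{ a rectifiable curve with } B(\Gamma,r)\supset E\}$. *)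

(* Defs.v *)
From HB Require Import structures.
From mathcomp Require Import all_boot all_order all_algebra.
From mathcomp Require Import all_classical all_reals all_analysis.
Set Implicit Arguments. Unset Strict Implicit. Unset Printing Implicit Defensive.
Import Order.TTheory GRing.Theory Num.Theory.
Local Open Scope classical_set_scope.
Local Open Scope ring_scope.

Definition enorm {R : realType} {n : nat} (v : 'rV[R]_n) : R :=
  Num.sqrt (\sum_(i < n) v ord0 i ^+ 2).
Definition edist {R : realType} {n : nat} (x y : 'rV[R]_n) : R := enorm (x - y).

Definition bi_holder {R : realType} {n : nat} (alpha beta Cg : R)
  (gamma : R -> 'rV[R]_n) : Prop :=
  forall x y, x \in `[0, 1] -> y \in `[0, 1] ->
    Cg^-1 * `|x - y| `^ beta <= edist (gamma x) (gamma y) /\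
    edist (gamma x) (gamma y) <= Cg * `|x - y| `^ alpha.

Definition curve_image {R : realType} {n : nat} (gamma : R -> 'rV[R]_n)
  : set 'rV[R]_n := gamma @` `[0, 1]%classic.

Definition dist_set {R : realType} {n : nat} (x : 'rV[R]_n) (A : set 'rV[R]_n) : R :=
  inf [set edist x a | a in A].
Definition closed_nbhd {R : realType} {n : nat} (A : set 'rV[R]_n) (r : R)
  : set 'rV[R]_n := [set x | dist_set x A <= r].

Definition rectifiable_curve {R : realType} {n : nat} (G : set 'rV[R]_n) : Prop :=
  exists (f : R -> 'rV[R]_n) (L : R),
    (forall s t, s \in `[0, 1] -> t \in `[0, 1] ->
       edist (f s) (f t) <= L * `|s - t|) /\
    G = f @` `[0, 1]%classic.

(* diameter (extended real, diam set0 = 0) *)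
Definition ediam {R : realType} {n : nat} (A : set 'rV[R]_n) : \bar R :=
  ereal_sup ([set (edist x y)%:E | x in A & y in A] `|` [set 0%E]).

(* one-dimensional Hausdorff measure (normalised so that H^1 of a segment
   is its length) via delta-covers *)
Definition hausdorff1_delta {R : realType} {n : nat} (delta : R)
  (A : set 'rV[R]_n) : \bar R :=
  ereal_inf [set (\sum_(0 <= i <oo) ediam (F i))%E |
     F in [set F : nat -> set 'rV[R]_n |
       A `<=` \bigcup_i F i /\ forall i, (ediam (F i) <= delta%:E)%E]].
Definition hausdorff1 {R : realType} {n : nat} (A : set 'rV[R]_n) : \bar R :=
  ereal_sup [set hausdorff1_delta d A | d in [set d : R | 0 < d]].

Definition Lambda {R : realType} {n : nat} (E : set 'rV[R]_n) (r : R) : \bar R :=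
  ereal_inf [set hausdorff1 G | G in
    [set G : set 'rV[R]_n | rectifiable_curve G /\ E `<=` closed_nbhd G r]].

(* Main.v *)
Require Import Defs.
From HB Require Import structures.
From mathcomp Require Import all_boot all_order all_algebra.
From mathcomp Require Import all_classical all_reals all_analysis.
From mathcomp Require Import ring lra.
Import Order.TTheory GRing.Theory Num.Theory.
Import numFieldNormedType.Exports.
Local Open Scope classical_set_scope.
Local Open Scope ring_scope.

(** Lower bound: with d = (8 Cg r)^(1/beta), the points gamma(k d) are
    8r-separated, so a competitor G contains about 1/d points p_k that are
    4r-separated.  As G is connected and leaves each ball B(p_k, r), the
    1-Lipschitz function |. - p_k| maps its part in that ball onto [0, r], which
    therefore costs length at least r; a set of diameter at most r meets only
    one of the balls, so these costs add up to r / d.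

    Upper bound: with d = (r / Cg)^(1/alpha), every point of B(gamma, r) is
    within 3r of some gamma(k d).  Put a copy of a finite r-net of the ball of
    radius 3r around each gamma(k d) and join all these points by a polygonal
    path: it has O(1/d) edges of length O(r). *)

(* The analysis library has its own [edist]. *)
Local Notation edist := Defs.edist.

(** * Euclidean norm, distance to a set, and diameter *)

Section EuclideanNorm.
Context {R : realType} {n : nat}.
Implicit Types (u v w : 'rV[R]_n) (a : R).

Lemma enorm_ge0 v : 0 <= enorm v.
Proof. exact: sqrtr_ge0. Qed.

Lemma enorm_sqr v : enorm v ^+ 2 = \sum_(i < n) v ord0 i ^+ 2.
Proof. by rewrite sqr_sqrtr// sumr_ge0// => i _; exact: sqr_ge0. Qed.

(** Cauchy-Schwarz: [quad] says that [a *: u + b *: v] has nonnegative squared norm, and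
    [a = enorm v], [b = - enorm u] gives the claim after division by the norms. *)
Lemma dot_le_enorm u v :
  \sum_(i < n) u ord0 i * v ord0 i <= enorm u * enorm v.
Proof.
set s := \sum_(i < n) _.
have quad (a b : R) :
    0 <= a ^+ 2 * enorm u ^+ 2 + (a * b * s) *+ 2 + b ^+ 2 * enorm v ^+ 2.
  rewrite !enorm_sqr /s !mulr_sumr -sumrMnl -!big_split/=.
  rewrite sumr_ge0// => i _.
  by rewrite [leRHS](_ : _ = (a * u ord0 i + b * v ord0 i) ^+ 2) ?sqr_ge0//; ring.
have [u0|u0] := eqVneq (enorm u) 0.
  have [s0|s0] := leP s 0; first by rewrite u0 mul0r.
  (* With [enorm u = 0] this choice makes the form equal to [- s ^+ 2 * (enorm v ^+ 2 + 2)],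
     negative for [s > 0]. *)
  have := quad (enorm v ^+ 2 + 1) (- s).
  have := sqr_ge0 (enorm v).
  rewrite u0; nra.
have up : 0 < enorm u by rewrite lt_def u0 enorm_ge0.
have [v0|v0] := eqVneq (enorm v) 0.
  have [s0|s0] := leP s 0; first by rewrite v0 mulr0.
  have := quad (- s) (enorm u ^+ 2 + 1).
  have := sqr_ge0 (enorm u).
  rewrite v0; nra.
have vp : 0 < enorm v by rewrite lt_def v0 enorm_ge0.
have := quad (enorm v) (- enorm u).
rewrite [X in 0 <= X](_ : _ = (enorm u * enorm v - s) * (enorm u * enorm v) *+ 2); last by ring.
by rewrite pmulrn_lge0// pmulr_lge0 ?mulr_gt0// subr_ge0.
Qed.

Lemma enormD u v : enorm (u + v) <= enorm u + enorm v.
Proof.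
rewrite -(@ler_pXn2r _ 2)// ?nnegrE ?addr_ge0 ?enorm_ge0//.
rewrite sqrrD !enorm_sqr.
under eq_bigr do rewrite mxE sqrrD.
by rewrite !big_split/= lerD2r lerD2l mulr2n lerD// dot_le_enorm.
Qed.

Lemma enormZ a v : enorm (a *: v) = `|a| * enorm v.
Proof.
rewrite /enorm; under eq_bigr do rewrite mxE exprMn.
by rewrite -mulr_sumr sqrtrM ?sqr_ge0// sqrtr_sqr.
Qed.

Lemma enormN v : enorm (- v) = enorm v.
Proof. by rewrite -scaleN1r enormZ normrN1 mul1r. Qed.

Lemma enorm0 : enorm (0 : 'rV[R]_n) = 0.
Proof. by rewrite -(scale0r (0 : 'rV_n)) enormZ normr0 mul0r. Qed.

Lemma enorm_sum (I : Type) (s : seq I) (F : I -> 'rV[R]_n) :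
  enorm (\sum_(i <- s) F i) <= \sum_(i <- s) enorm (F i).
Proof.
elim/big_rec2: _ => [|i y x _ le_xy]; first by rewrite enorm0.
by rewrite (le_trans (enormD _ _))// lerD2l.
Qed.

Lemma edist_ge0 u v : 0 <= edist u v.
Proof. exact: enorm_ge0. Qed.

Lemma edistxx u : edist u u = 0.
Proof. by rewrite /edist subrr enorm0. Qed.

Lemma edistC u v : edist u v = edist v u.
Proof. by rewrite /edist -enormN opprB. Qed.

Lemma edist_triangle v u w : edist u w <= edist u v + edist v w.
Proof. by rewrite /edist (le_trans _ (enormD _ _))// addrA subrK. Qed.

Lemma dist_edist_le u v w : `|edist u w - edist v w| <= edist u v.
Proof.
have := edist_triangle v u w; have := edist_triangle u v w.
rewrite (edistC v u) ler_norml => ? ?; apply/andP; split; lra.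
Qed.

Lemma dist_set_le u v (A : set 'rV[R]_n) : A v -> dist_set u A <= edist u v.
Proof.
move=> Av; apply: ge_inf; last by exists v.
by exists 0 => _ [w _ <-]; exact: edist_ge0.
Qed.

(** The infimum in [dist_set] need not be attained, so a near point of [A] is found only at the
    price of a strictly larger radius; below, [s = 2 * r]. *)
Lemma closed_nbhd_lt u (A : set 'rV[R]_n) (r s : R) :
  A !=set0 -> r < s -> closed_nbhd A r u -> exists2 v, A v & edist u v < s.
Proof.
move=> [w Aw] rs ur; have : dist_set u A < s by exact: le_lt_trans ur rs.
have dne : [set edist u a | a in A] !=set0 by exists (edist u w), w.
by move=> /(inf_lt dne)[_ [v Av <-] vs]; exists v.
Qed.

Lemma ediam_le (A : set 'rV[R]_n) (d : R) : 0 <= d ->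
  (forall u v, A u -> A v -> edist u v <= d) -> (ediam A <= d%:E)%E.
Proof.
move=> d0 Ad; apply: ge_ereal_sup => _ [[u Au [v Av <-]]|->].
  by rewrite lee_fin Ad.
by rewrite lee_fin.
Qed.

Lemma ediam_ge0 (A : set 'rV[R]_n) : (0 <= ediam A)%E.
Proof. by rewrite /ediam; apply: ereal_sup_ubound; right. Qed.

Lemma edist_le_ediam (A : set 'rV[R]_n) u v : A u -> A v ->
  ((edist u v)%:E <= ediam A)%E.
Proof.
by move=> Au Av; rewrite /ediam; apply: ereal_sup_ubound; left; exists u => //; exists v.
Qed.

End EuclideanNorm.

(** * Length of a Lipschitz image *)

Section HausdorffLipschitz.
Context {R : realType} {n : nat}.

(** The images of [k.+1] equal subintervals have diameter at most [L / k.+1], which is below any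
    given mesh for large [k], while the total stays at most [L]. *)
Lemma hausdorff1_lipschitz_le (f : R -> 'rV[R]_n) (L : R) :
  (forall s t, s \in `[0, 1] -> t \in `[0, 1] ->
     edist (f s) (f t) <= L * `|s - t|) ->
  (hausdorff1 (f @` `[0%R, 1%R]%classic) <= L%:E)%E.
Proof.
move=> fL.
have L0 : 0 <= L.
  have i01 : (0 : R) \in `[0, 1] by rewrite in_itv/= lexx ler01.
  have i11 : (1 : R) \in `[0, 1] by rewrite in_itv/= lexx ler01.
  have := fL _ _ i11 i01; rewrite subr0 normr1 mulr1.
  by apply: le_trans; exact: edist_ge0.
apply: ge_ereal_sup => _ [d d0 <-].
pose k := Num.truncn (L / d).
have k0 : 0 < k.+1%:R :> R by rewrite ltr0n.
have Lk : L / k.+1%:R <= d.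
  by rewrite ler_pdivrMr// mulrC -ler_pdivrMr// ltW// truncnS_gt.
have Lk0 : 0 <= L / k.+1%:R by rewrite divr_ge0// ltW.
(* Pieces of index above [k] are empty, which pads the finite cover to a sequence. *)
pose piece (i : nat) := [set t : R | t \in `[0, 1] /\
  ((i < k.+1)%N /\ i%:R <= t * k.+1%:R <= i.+1%:R)].
have diam_piece i : (ediam (f @` piece i) <= (L / k.+1%:R)%:E)%E.
  apply: ediam_le => // _ _ [s [s01 [_ /andP[s1 s2]]] <-] [t [t01 [_ /andP[t1 t2]]] <-].
  apply: le_trans (fL _ _ s01 t01) _.
  rewrite ler_wpM2l// -[leRHS]div1r ler_pdivlMr//.
  rewrite -[X in _ * X]gtr0_norm// -normrM mulrBl ler_norml.
  by move: s1 s2 t1 t2; rewrite -natr1; lra.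
rewrite /hausdorff1_delta; apply: ge_ereal_inf.
exists (\sum_(0 <= i <oo) ediam (f @` piece i))%E.
  exists (fun i => f @` piece i) => //; split; last first.
    by move=> i; rewrite (le_trans (diam_piece i))// lee_fin.
  (* The minimum with [k] serves [t = 1], where the truncation would give [k.+1]. *)
  move=> _ [t t01 <-]; exists (minn (Num.truncn (t * k.+1%:R)) k) => //.
  exists t => //; split => //; split; first by rewrite ltnS geq_minr.
  have /andP[t0 t1] : 0 <= t <= 1 by move: t01; rewrite /= in_itv.
  have tk0 : 0 <= t * k.+1%:R by rewrite mulr_ge0// ltW.
  have /andP[tk1 tk2] := truncn_itv tk0.
  rewrite /minn; case: ifPn => [_|]; first by rewrite tk1 ltW.
  rewrite -leqNgt => kt; rewrite (le_trans _ tk1) ?ler_nat//=.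
  by rewrite -[leRHS]mul1r ler_wpM2r// ltW.
rewrite (nneseries_split 0 k.+1); last by move=> *; exact: ediam_ge0.
rewrite [X in (_ + X)%E]eseries0 ?adde0; last first.
  move=> i; rewrite add0n => ki _.
  rewrite (_ : piece i = set0) ?image_set0; last first.
    by apply/seteqP; split => // t [_ [ik _]]; move: ki ik; rewrite leqNgt => /negP.
  by apply/eqP; rewrite eq_le ediam_ge0 andbT; apply: ediam_le.
rewrite add0n big_mkord (@le_trans _ _ (\sum_(i < k.+1) (L / k.+1%:R)%:E)%E)//.
  by apply: lee_sum => i _.
rewrite sumEFin sumr_const card_ord lee_fin -[X in X <= _]mulr_natr divfK// gt_eqF//.
Qed.

End HausdorffLipschitz.

(** * Length of a curve through separated points *)

Section Covering.
Context {R : realType}.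

(** Each [A i] lies in the closed interval of length [w i] starting at [inf (A i)]; these are
    measurable, so Lebesgue measure is subadditive on them. *)
Lemma interval_cover_le (r : R) (A : nat -> set R) (w : nat -> R) :
  0 <= r -> (forall i, 0 <= w i) ->
  (forall i x y, A i x -> A i y -> `|x - y| <= w i) ->
  `[0, r]%classic `<=` \bigcup_i A i ->
  (r%:E <= \sum_(0 <= i <oo) (w i)%:E)%E.
Proof.
move=> r0 w0 Aw cov.
have len (a l : R) : 0 <= l -> lebesgue_measure `[a, (a + l)]%classic = l%:E.
  move=> l0; rewrite lebesgue_measure_itv/= lte_fin.
  case: ltP => [_|]; first by rewrite -EFinB addrAC subrr add0r.
  by rewrite gerDl => ?; congr EFin; apply/eqP; rewrite eq_le l0.
rewrite -(len 0 r r0) add0r.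
rewrite -(eq_eseriesr (fun i _ => len (inf (A i)) _ (w0 i))).
apply: measure_sigma_subadditive => // x /cov[i _ Aix]; exists i => //=.
rewrite in_itv/=; apply/andP; split.
  apply: ge_inf => //; exists (x - w i) => y Aiy.
  by have := Aw _ _ _ Aix Aiy; rewrite ler_norml => /andP[_]; lra.
rewrite -lerBlDr; apply: lb_le_inf; first by exists x.
move=> y Aiy.
by have := Aw _ _ _ Aix Aiy; rewrite ler_norml => /andP[_]; lra.
Qed.

Lemma lipschitz_IVT (g : R -> R) (L a b v : R) :
  (forall s t, s \in `[0, 1] -> t \in `[0, 1] -> `|g s - g t| <= L * `|s - t|) ->
  a \in `[0, 1] -> b \in `[0, 1] -> g a <= v <= g b ->
  exists2 t, t \in `[0, 1] & g t = v.
Proof.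
move=> gL a01 b01 gv.
(* A positive constant is wanted for the choice of radius [e / L] in the continuity proof. *)
wlog L0 : L gL / 0 < L.
  move=> /(_ (`|L| + 1)); apply; last by rewrite ltr_wpDl.
  move=> s t s01 t01; apply: le_trans (gL _ _ s01 t01) _.
  by rewrite ler_wpM2r// (le_trans (ler_norm _))// lerDl.
have gcont (c d : R) : c \in `[0, 1] -> d \in `[0, 1] -> {within `[c, d], continuous g}.
  move=> c01 d01; apply/subspace_continuousP => x /= xcd.
  have sub (t : R) : t \in `[c, d] -> t \in `[0, 1].
    by move: c01 d01; rewrite !in_itv/= => /andP[? ?] /andP[? ?] /andP[? ?]; apply/andP; split; lra.
  apply/cvgrPdist_le => e e0; rewrite near_withinE.
  near=> t => tcd; apply: le_trans (gL _ _ (sub _ xcd) (sub _ tcd)) _.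
  rewrite mulrC -ler_pdivlMr// ltW//.
  have : ball x (e / L) t by near: t; apply: nbhsx_ballx; rewrite divr_gt0.
  by rewrite -ball_normE.
have [ab|ba] := leP a b.
  have [|t tab <-] := IVT ab (gcont _ _ a01 b01) (v := v).
    by rewrite ge_min le_max; case/andP: gv => -> ->; rewrite orbT.
  exists t => //; move: a01 b01 tab; rewrite !in_itv/=.
  by move=> /andP[? ?] /andP[? ?] /andP[? ?]; apply/andP; split; lra.
have [|t tab <-] := IVT (ltW ba) (gcont _ _ b01 a01) (v := v).
  by rewrite ge_min le_max; case/andP: gv => -> ->; rewrite orbT.
exists t => //; move: a01 b01 tab; rewrite !in_itv/=.
by move=> /andP[? ?] /andP[? ?] /andP[? ?]; apply/andP; split; lra.
Unshelve. all: end_near. Qed.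

Lemma separated_le_hausdorff1 (n : nat) (G : set 'rV[R]_n) (N : nat)
    (p : 'I_N -> 'rV[R]_n) (r : R) :
  0 < r -> (1 < N)%N -> rectifiable_curve G -> (forall k, G (p k)) ->
  (forall k j, k != j -> 4 * r <= edist (p k) (p j)) ->
  ((N%:R * r)%:E <= hausdorff1 G)%E.
Proof.
move=> r0 N1 [f [L [fL Gf]]] Gp sep.
apply: (@le_trans _ _ (hausdorff1_delta r G)); last first.
  by rewrite /hausdorff1; apply: ereal_sup_ubound; exists r.
apply: le_ereal_inf_tmp => _ [F [GF Fr] <-].
have dfin i : (fine (ediam (F i)))%:E = ediam (F i).
  rewrite fineK// ge0_fin_numE ?ediam_ge0//.
  by rewrite (le_lt_trans (Fr i))// ltry.
have d0 i : 0 <= fine (ediam (F i)) by rewrite fine_ge0// ediam_ge0.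
pose meets (k : 'I_N) i := `[< exists2 x, F i x & edist x (p k) <= r >].
(* The cost of [F i] charged to the ball around [p k]. *)
pose w k i := if meets k i then fine (ediam (F i)) else 0.
have w0 k i : 0 <= w k i by rewrite /w; case: ifP.
apply: (@le_trans _ _ (\sum_(k < N) \sum_(0 <= i <oo) (w k i)%:E)%E).
  rewrite mulr_natl -[X in _ *+ X](card_ord N) -sumr_const -sumEFin.
  apply: lee_sum => k _.
  (* The sets on the line are the distances to [p k], up to [r], that [F i] realizes. *)
  apply: (@interval_cover_le _
    (fun i => [set y | y <= r /\ exists2 x, F i x & edist x (p k) = y])) => //.
  - exact: ltW.
  - move=> i _ z' [/[swap] -[y Fy <-] yr] [_ [z Fz <-]].
    rewrite /w (_ : meets k i); last by apply/asboolP; exists y.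
    apply: le_trans (dist_edist_le _ _ _) _.
    by rewrite -lee_fin dfin; exact: edist_le_ediam.
  - move=> y /=; rewrite in_itv/= => /andP[y0 yr].
    (* A second point, available as [1 < N], lies at distance at least [4 * r]: on the way to it the
       curve realizes every distance in [[0, r]]. *)
    have [j jk] : exists j : 'I_N, j != k.
      have [->|k0] := eqVneq k (Ordinal (ltnW N1)); last first.
        by exists (Ordinal (ltnW N1)); rewrite eq_sym.
      by exists (Ordinal N1).
    have := Gp j; have := Gp k; rewrite Gf => -[a a01 fa] [b b01 fb].
    have [||||t t01 fty] := @lipschitz_IVT (fun t => edist (f t) (p k)) L a b y.
    + move=> s t s01 t01; apply: le_trans (dist_edist_le _ _ _) _; exact: fL.
    + exact: a01.
    + exact: b01.
    + rewrite fa fb edistxx y0/= (le_trans _ (sep _ _ jk))//; lra.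
    have [i _ Fi] : (\bigcup_i F i) (f t) by apply: GF; rewrite Gf; exists t.
    by exists i => //; split => //; exists (f t).
rewrite -nneseries_sum; last by move=> *; rewrite lee_fin.
apply: lee_nneseries => [i _ _|i _]; first by rewrite sume_ge0// => k _; rewrite lee_fin.
(* Each [F i] is charged at most once: meeting the balls of [p k] and [p j] would put these centres
   within [r + r + r < 4 * r]. *)
have [[k kP]|noP] := pselect (exists k, meets k i); last first.
  rewrite big1 ?ediam_ge0// => k _; rewrite /w ifN//.
  by apply/negP => kP; apply: noP; exists k.
rewrite (bigD1 k)//= big1 ?adde0; first by rewrite /w kP dfin.
move=> j jk; rewrite /w ifN//; apply/negP => /asboolP[y Fy yr].
move/asboolP : kP => [x Fx xr].
have xy : edist x y <= r.
  by rewrite -lee_fin (le_trans (edist_le_ediam _ _ _ Fx Fy)).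
have := sep _ _ jk; apply/negP; rewrite -ltNge.
have := edist_triangle y (p j) (p k); have := edist_triangle x y (p k).
rewrite (edistC (p j) y) (edistC y x); lra.
Qed.

End Covering.

(** * Polygonal paths and their Lipschitz constant *)

Section PolygonalPath.
Context {R : realType} {n : nat}.

Definition clamp01 (x : R) : R := Num.max 0 (Num.min 1 x).

Lemma clamp01_le (x y : R) : x <= y -> clamp01 x <= clamp01 y.
Proof. by move=> xy; rewrite le_max2// le_min2. Qed.

(** [clamp01 (u - i)] is the length of the part of [[i, i + 1]] below [u]; these parts add up to the
    part of [[0, N]] below [u]. *)
Lemma sum_clamp01 (N : nat) (u : R) :
  \sum_(i < N) clamp01 (u - i%:R) = Num.max 0 (Num.min N%:R u).
Proof.
elim: N => [|N IH]; first by rewrite big_ord0 max_l// ge_min lexx.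
rewrite big_ord_recr/= IH /clamp01 -natr1.
have N0 : 0 <= N%:R :> R by rewrite ler0n.
have [uN|/ltW Nu] := leP u N%:R.
  rewrite (min_r (x := 1)); last lra.
  by rewrite (max_l (y := u - _)) ?addr0 ?min_r//; lra.
rewrite (max_r N0).
have [uN1|/ltW Nu1] := leP u (N%:R + 1).
  by rewrite (min_r (x := 1)) ?max_r; lra.
by rewrite (min_l (x := 1)) ?max_r; lra.
Qed.

(* For [N = 0] the path is constant, and the vertex times [k / N] are [0]. *)
Definition polygonal_path (p : nat -> 'rV[R]_n) (N : nat) (t : R) : 'rV[R]_n :=
  p 0%N + \sum_(i < N) clamp01 (t * N%:R - i%:R) *: (p i.+1 - p i).

(** At this time the edges before [k] have weight 1 and the others weight 0, so the sum
    telescopes. *)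
Lemma polygonal_path_vertex (p : nat -> 'rV[R]_n) (N k : nat) : (k <= N)%N ->
  polygonal_path p N (k%:R / N%:R) = p k.
Proof.
move=> kN; rewrite /polygonal_path.
have -> : k%:R / N%:R * N%:R = k%:R :> R.
  case: N kN => [|N] kN; last by rewrite divfK// pnatr_eq0.
  by move: kN; rewrite leqn0 => /eqP ->; rewrite mulr0.
rewrite -(big_mkord xpredT (fun i => clamp01 (k%:R - i%:R) *: (p i.+1 - p i))).
rewrite (big_cat_nat (n := k))//= [X in _ + (_ + X)]big_nat_cond.
rewrite [X in _ + (_ + X)]big1 ?addr0; last first.
  move=> i /andP[/andP[ki _] _]; rewrite /clamp01.
  have ki' : k%:R <= i%:R :> R by rewrite ler_nat.
  by rewrite max_l ?scale0r// ge_min subr_le0 ki' orbT.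
rewrite big_nat_cond (eq_bigr (fun i => p i.+1 - p i)); last first.
  move=> i /andP[/andP[_ ik] _]; rewrite /clamp01 min_l ?max_r ?scale1r//.
  by rewrite lerBrDr nat1r ler_nat.
by rewrite -big_nat_cond telescope_sumr// addrC subrK.
Qed.

(* The weights of the edges are nondecreasing in [t] and their sum is [t * N],
   so their variations add up to [N * |s - t|]. *)
Lemma polygonal_path_lipschitz (p : nat -> 'rV[R]_n) (N : nat) (D : R) :
  (forall i, (i < N)%N -> edist (p i) (p i.+1) <= D) ->
  forall s t, s \in `[0, 1] -> t \in `[0, 1] ->
  edist (polygonal_path p N s) (polygonal_path p N t) <= N%:R * D * `|s - t|.
Proof.
move=> pD s t; wlog st : s t / s <= t.
  move=> wl s01 t01; have [st|/ltW ts] := leP s t; first exact: wl.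
  by rewrite edistC distrC wl.
rewrite !in_itv/= => /andP[s0 s1] /andP[t0 t1].
have sN : s * N%:R <= t * N%:R by rewrite ler_wpM2r.
have sN1 : s * N%:R <= N%:R by rewrite ler_piMl.
have tN1 : t * N%:R <= N%:R by rewrite ler_piMl.
have sN0 : 0 <= s * N%:R by rewrite mulr_ge0.
rewrite edistC /Defs.edist /polygonal_path opprD addrACA subrr add0r -sumrB.
apply: le_trans (enorm_sum _ _ _) _.
apply: (@le_trans _ _ (\sum_(i < N)
    (clamp01 (t * N%:R - i%:R) - clamp01 (s * N%:R - i%:R)) * D)).
  apply: ler_sum => i _; rewrite -scalerBl enormZ ger0_norm; last first.
    by rewrite subr_ge0 clamp01_le// lerD2r.
  rewrite ler_wpM2l ?subr_ge0 ?clamp01_le ?lerD2r//.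
  by have := pD i (ltn_ord i); rewrite edistC.
rewrite -mulr_suml sumrB !sum_clamp01 !min_r// !max_r ?(le_trans sN0)//.
rewrite distrC ger0_norm ?subr_ge0// -mulrBl.
by rewrite [leRHS](_ : _ = (t - s) * N%:R * D)//; ring.
Qed.

End PolygonalPath.

(** * A net of the ball of radius 3, and powers of the scale *)

(** Rounding coordinates down to a grid of mesh [h = 1 / (n + 1)] on [[-3, 3]] costs at most
    [h ^+ 2 <= h] per coordinate in the squared distance, hence at most [n * h <= 1] in all. *)
Lemma finite_net (R : realType) (n : nat) : exists (Q : nat) (z : nat -> 'rV[R]_n),
  (0 < Q)%N /\
  forall v, enorm v <= 3 -> exists2 j, (j < Q)%N & edist v (z j) <= 1.
Proof.
pose h : R := n.+1%:R^-1.
have h0 : 0 < h by rewrite invr_gt0.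
pose K := (6 * n.+1).+1.
pose I := {ffun 'I_n -> 'I_K}.
pose grid (k : I) : 'rV[R]_n := \row_i ((k i)%:R * h - 3).
have I0 : (0 < #|{: I}|)%N by apply/card_gt0P; exists [ffun=> ord0].
exists #|{: I}|, (fun j => if insub j is Some j' then grid (enum_val (j' : 'I_#|{: I}|)) else 0).
split=> // v v3.
have vi i : -3 <= v ord0 i <= 3.
  rewrite -ler_norml (le_trans _ v3)// -sqrtr_sqr ler_wsqrtr//.
  by rewrite (bigD1 i)//= lerDl sumr_ge0// => j _; exact: sqr_ge0.
have pos i : 0 <= (v ord0 i + 3) / h.
  by rewrite divr_ge0 ?(ltW h0)//; have /andP[] := vi i; lra.
have bnd i : (Num.truncn ((v ord0 i + 3) / h) < K)%N.
  rewrite -(@ltr_nat R) (le_lt_trans (y := (6 * n.+1)%:R)) ?ltr_nat//.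
  have /andP[tr _] := truncn_itv (pos i); apply: le_trans tr _.
  rewrite /h invrK natrM ler_wpM2r//; have /andP[_] := vi i; lra.
pose k : I := [ffun i => Ordinal (bnd i)].
exists (enum_rank k) => //; rewrite valK enum_rankK.
have near i : (v ord0 i - grid k ord0 i) ^+ 2 <= h.
  have /andP[lo hi] := truncn_itv (pos i).
  rewrite !mxE ffunE/=; move: lo hi; rewrite ler_pdivlMr// ltr_pdivrMr//.
  set m := (Num.truncn _); rewrite -(natr1 m) mulrDl mul1r => lo hi.
  have h1 : h <= 1 by rewrite invf_le1// ler1n.
  set e := (X in X ^+ 2).
  have e0 : 0 <= e by rewrite /e; lra.
  have eh : e <= h by rewrite /e; lra.
  by rewrite expr2 (le_trans _ eh)// ler_piMr// (le_trans eh).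
rewrite /Defs.edist /enorm -[leRHS]sqrtr1 ler_wsqrtr//.
under eq_bigr do rewrite mxE [X in (_ + X)]mxE.
apply: (@le_trans _ _ (\sum_(i < n) h)); first exact: ler_sum.
rewrite sumr_const card_ord -mulr_natl ler_pdivrMr// mul1r ler_nat//.
Qed.

Lemma powR_scale (R : realType) (a r b : R) : 0 < a -> 0 < r -> 0 < b ->
  ((a * r) `^ b^-1)^-1 * r = (a `^ b^-1)^-1 * r `^ ((b - 1) / b).
Proof.
move=> a0 r0 b0.
rewrite powRM ?(ltW a0) ?(ltW r0)// invfM -mulrA; congr (_ * _).
have -> : (b - 1) / b = - b^-1 + 1.
  by rewrite mulrBl divff ?gt_eqF// div1r addrC.
by rewrite powRD ?(gt_eqF r0) ?implybT// powRN powRr1// ltW.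
Qed.

Lemma powR_le1 (R : realType) (x a : R) : 0 <= x <= 1 -> 0 <= a -> x `^ a <= 1.
Proof.
move=> /andP[x0 x1] a0.
by have := ge0_ler_powR a0 x0 ler01 x1; rewrite powR1.
Qed.

Lemma mem_grid (R : realType) (d : R) (k : nat) :
  0 < d -> (k < (Num.truncn d^-1).+1)%N -> k%:R * d \in `[0, 1].
Proof.
move=> d0; rewrite ltnS => kd; rewrite in_itv/= mulr_ge0 ?(ltW d0)//=.
rewrite -ler_pdivlMr// div1r.
have /andP[h _] := truncn_itv (ltW (divr_gt0 ltr01 d0)).
by move: h; rewrite div1r; apply: le_trans; rewrite ler_nat.
Qed.

(** * Lower bound for [Lambda] *)

Lemma Lambda_ge (R : realType) (n : nat) (alpha beta Cg : R)
    (gamma : R -> 'rV[R]_n) (r : R) :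
  0 < beta -> 1 <= Cg -> bi_holder alpha beta Cg gamma ->
  0 < r -> r < (8 * Cg)^-1 ->
  ((((8 * Cg) `^ beta^-1)^-1 * r `^ ((beta - 1) / beta))%:E
     <= Lambda (closed_nbhd (curve_image gamma) r) r)%E.
Proof.
move=> beta0 Cg1 gammaH r0 r_small.
have c0 : 0 < 8 * Cg by rewrite mulr_gt0// (lt_le_trans ltr01).
have cr0 : 0 < 8 * Cg * r by rewrite mulr_gt0.
rewrite -powR_scale//; set d := _ `^ _.
have d0 : 0 < d by rewrite powR_gt0.
have dbeta : d `^ beta = 8 * Cg * r.
  by rewrite -powRrM mulVf ?gt_eqF// powRr1// ltW.
(* Smallness of [r] enters here: [d <= 1] leaves at least two sample points in [[0, 1]]. *)
have d1 : 1 <= d^-1.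
  rewrite invf_ge1// powR_le1 ?invr_ge0 ?(ltW beta0)// ltW//=.
  by rewrite ltW// mulrC -ltr_pdivlMr// div1r.
pose N := (Num.truncn d^-1).+1.
have N1 : (1 < N)%N by rewrite ltnS truncn_gt0.
apply: le_ereal_inf_tmp => _ [G [Grect Gcov] <-].
have G0 : G !=set0.
  by have [f [L [_ ->]]] := Grect; exists (f 0), 0 => //=; rewrite in_itv/= lexx ler01.
have /choice[p pP] (k : 'I_N) : exists v, G v /\ edist (gamma (k%:R * d)) v < 2 * r.
  have kd01 := mem_grid _ _ _ d0 (ltn_ord k).
  have [||v Gv vr] := closed_nbhd_lt (gamma (k%:R * d)) G r (2 * r) G0.
  - lra.
  - apply: Gcov; apply: le_trans (ltW r0).
    by rewrite -(edistxx (gamma (k%:R * d))); apply: dist_set_le; exists (k%:R * d).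
  - by exists v.
apply: (@le_trans _ _ (N%:R * r)%:E).
  by rewrite lee_fin ler_wpM2r ?(ltW r0)// ltW// truncnS_gt.
apply: (separated_le_hausdorff1 _ _ _ p) => // [k|k j kj]; first by have [] := pP k.
have [gkj _] := gammaH _ _ (mem_grid _ _ _ d0 (ltn_ord k)) (mem_grid _ _ _ d0 (ltn_ord j)).
have djk : d <= `|k%:R * d - j%:R * d|.
  rewrite -mulrBl normrM (gtr0_norm d0) ler_peMl ?(ltW d0)//.
  have [kltj|jltk|/val_inj kej] := ltngtP k j; last by rewrite kej eqxx in kj.
    by rewrite distrC ger0_norm ?subr_ge0 ?ler_nat ?(ltnW kltj)// lerBrDr nat1r ler_nat.
  by rewrite ger0_norm ?subr_ge0 ?ler_nat ?(ltnW jltk)// lerBrDr nat1r ler_nat.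
(* The factor 8 in [d] gives [8 * r]; replacing both points by points of [G] loses less than [2 * r]
   each and leaves [4 * r]. *)
have far : 8 * r <= edist (gamma (k%:R * d)) (gamma (j%:R * d)).
  apply: le_trans gkj; rewrite [leRHS]mulrC ler_pdivlMr ?(lt_le_trans ltr01)//.
  by rewrite mulrAC -dbeta ge0_ler_powR ?nnegrE ?(ltW d0)// ltW.
have [[_ pk] [_ pj]] := (pP k, pP j).
have := edist_triangle (p k) (gamma (k%:R * d)) (gamma (j%:R * d)).
have := edist_triangle (p j) (p k) (gamma (j%:R * d)).
rewrite (edistC (p j)); lra.
Qed.

(** * Upper bound for [Lambda] *)

Lemma Lambda_le (R : realType) (n : nat) (alpha beta Cg : R)
    (gamma : R -> 'rV[R]_n) (Q : nat) (z : nat -> 'rV[R]_n) (r : R) :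
  0 < alpha -> 1 <= Cg -> bi_holder alpha beta Cg gamma ->
  (0 < Q)%N ->
  (forall v, enorm v <= 3 -> exists2 j, (j < Q)%N & edist v (z j) <= 1) ->
  0 < r -> r <= 1 ->
  (Lambda (closed_nbhd (curve_image gamma) r) r <=
   (2 * Q%:R * (1 + 2 * \sum_(j < Q) enorm (z j)) * (Cg^-1 `^ alpha^-1)^-1 *
      r `^ ((alpha - 1) / alpha))%:E)%E.
Proof.
move=> alpha0 Cg1 gammaH Q0 zQ r0 r1.
have Cg0 : 0 < Cg by rewrite (lt_le_trans ltr01).
have rC0 : 0 < Cg^-1 * r by rewrite mulr_gt0// invr_gt0.
set b := \sum_(j < Q) _.
have zb j : (j < Q)%N -> enorm (z j) <= b.
  move=> jQ; rewrite /b (bigD1 (Ordinal jQ))//= lerDl sumr_ge0// => i _.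
  exact: enorm_ge0.
have b0 : 0 <= b by rewrite (le_trans _ (zb _ Q0))// enorm_ge0.
rewrite -mulrA -powR_scale ?invr_gt0//; set d := _ `^ _.
have d0 : 0 < d by rewrite powR_gt0.
have dalpha : Cg * d `^ alpha = r.
  by rewrite -powRrM mulVf ?gt_eqF// powRr1 ?(ltW rC0)// mulrA divff ?mul1r ?gt_eqF.
have d1 : 1 <= d^-1.
  rewrite invf_ge1// powR_le1 ?invr_ge0 ?(ltW alpha0)// ltW//=.
  by rewrite mulrC ler_pdivrMr// mul1r (le_trans r1).
have step s t : s \in `[0, 1] -> t \in `[0, 1] -> `|s - t| <= d ->
    edist (gamma s) (gamma t) <= r.
  move=> s01 t01 st; have [_ gst] := gammaH _ _ s01 t01; apply: le_trans gst _.
  by rewrite -dalpha ler_wpM2l ?(ltW Cg0)// ge0_ler_powR ?nnegrE ?(ltW alpha0) ?(ltW d0).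
pose M := (Num.truncn d^-1).+1.
(* The quotient of [m] by [Q] selects the point of the curve, the remainder the net point around it,
   scaled by [r]. *)
pose p (m : nat) := gamma ((m %/ Q)%:R * d) + r *: z (m %% Q)%N.
pose N := (M * Q).-1.
have NS : N.+1 = (M * Q)%N by rewrite prednK// muln_gt0.
have in01 m : (m <= N)%N -> (m %/ Q)%:R * d \in `[0, 1].
  by move=> mN; apply: mem_grid => //; rewrite ltn_divLR// -/M -NS.
(* The curve point moves by at most [r], as its parameter moves by 0 or [d]; two scaled net points
   differ by at most [2 * b * r]. *)
have pstep i : (i < N)%N -> edist (p i) (p i.+1) <= r * (1 + 2 * b).
  move=> iN; rewrite /Defs.edist opprD addrACA -scalerBr.
  apply: le_trans (enormD _ _) _; rewrite mulrDr mulr1 lerD//.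
    apply: step; [exact/in01/ltnW | exact: in01 |].
    rewrite -mulrBl normrM (gtr0_norm d0) ler_piMl ?(ltW d0)//.
    have le1 : (i %/ Q <= i.+1 %/ Q)%N by rewrite leq_div2r.
    have le2 : (i.+1 %/ Q <= (i %/ Q).+1)%N.
      have -> : (i %/ Q).+1 = ((i + Q) %/ Q)%N by rewrite divnDr// divnn Q0 addn1.
      by rewrite leq_div2r// -addn1 leq_add2l.
    by rewrite distrC ger0_norm ?subr_ge0 ?ler_nat// lerBlDl natr1 ler_nat.
  rewrite enormZ gtr0_norm// ler_wpM2l ?(ltW r0)//.
  apply: le_trans (enormD _ _) _; rewrite enormN mulr_natl mulr2n lerD//.
    by rewrite zb// ltn_mod.
  by rewrite zb// ltn_mod.
have plip := polygonal_path_lipschitz p N _ pstep.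
rewrite /Lambda; apply: ge_ereal_inf.
exists (hausdorff1 (polygonal_path p N @` `[0%R, 1%R]%classic)); last first.
  apply: le_trans (hausdorff1_lipschitz_le _ _ plip) _; rewrite lee_fin.
  rewrite [leRHS](_ : _ = (2 * d^-1 * Q%:R) * (r * (1 + 2 * b))); last by ring.
  rewrite ler_wpM2r//; first by rewrite mulr_ge0 ?(ltW r0)//; lra.
  (* [M <= d^-1 + 1 <= 2 * d^-1], since [1 <= d^-1]. *)
  apply: (@le_trans _ _ (M * Q)%:R); first by rewrite ler_nat -NS.
  rewrite natrM ler_wpM2r// /M -natr1.
  have /andP[tr _] := truncn_itv (le_trans ler01 d1); lra.
exists (polygonal_path p N @` `[0%R, 1%R]%classic) => //; split.
  by exists (polygonal_path p N), (N%:R * (r * (1 + 2 * b))).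
move=> u /(closed_nbhd_lt u _ r (2 * r))[||_ [t t01 <-] ut].
- by exists (gamma 0), 0 => //=; rewrite in_itv/= lexx ler01.
- lra.
have /andP[t0 t1] : 0 <= t <= 1 by move: t01; rewrite /= in_itv.
have td0 : 0 <= t / d by rewrite divr_ge0// ltW.
pose k := Num.truncn (t / d).
have kM : (k < M)%N.
  by rewrite ltnS le_truncn// ler_piMl// invr_ge0 ltW.
(* [2 * r] from [u] to [gamma t] and [r] from there to the grid point: this is why the net covers
   radius 3. *)
have uk : edist u (gamma (k%:R * d)) <= 3 * r.
  have tk : edist (gamma t) (gamma (k%:R * d)) <= r.
    apply: step => //; first exact: mem_grid.
    have /andP[lo hi] := truncn_itv td0.
    move: lo hi; rewrite -/k ler_pdivlMr// ltr_pdivrMr// -natr1 mulrDl mul1r => lo hi.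
    by rewrite ger0_norm; lra.
  have := edist_triangle (gamma t) u (gamma (k%:R * d)); lra.
have [|j jQ vz] := zQ (r^-1 *: (u - gamma (k%:R * d))).
  by rewrite enormZ gtr0_norm ?invr_gt0// mulrC ler_pdivrMr.
have mN : (k * Q + j <= N)%N.
  by rewrite -ltnS NS -ltn_divLR// divnMDl// divn_small// addn0.
have up : edist u (p (k * Q + j)%N) <= r.
  rewrite /p divnMDl// divn_small// addn0 modnMDl modn_small//.
  rewrite (_ : edist _ _ = r * edist (r^-1 *: (u - gamma (k%:R * d))) (z j)).
    by rewrite ler_piMr// ltW.
  have scale v : r * enorm v = enorm (r *: v) by rewrite enormZ gtr0_norm.
  rewrite /Defs.edist scale scalerBr scalerA.
  by rewrite divff ?gt_eqF// scale1r opprD addrA.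
apply: le_trans up; apply: dist_set_le.
exists ((k * Q + j)%:R / N%:R); last exact: polygonal_path_vertex.
rewrite /= in_itv/= divr_ge0//=.
(* For [N = 0] the time is 0, by the convention that the inverse of 0 is 0. *)
have [->|N0] := eqVneq N 0%N; first by rewrite invr0 mulr0.
by rewrite ler_pdivrMr ?mul1r ?ler_nat// ltr0n lt0n.
Qed.

Theorem theorem3p7 (R : realType) (beta Cg : R) :
  0 < beta -> 1 <= Cg ->
  exists r0 : R, 0 < r0 /\
  forall (n : nat) (alpha : R), 0 < alpha -> alpha <= beta -> alpha <= 1 ->
  exists C : R, 0 < C /\
  forall gamma : R -> 'rV[R]_n, bi_holder alpha beta Cg gamma ->
  forall r : R, 0 < r -> r < r0 ->
    ((C^-1 * r `^ ((beta - 1) / beta))%:E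
       <= Lambda (closed_nbhd (curve_image gamma) r) r)%E /\
    (Lambda (closed_nbhd (curve_image gamma) r) r
       <= (C * r `^ ((alpha - 1) / alpha))%:E)%E.
Proof.
move=> beta0 Cg1; have Cg0 : 0 < Cg by rewrite (lt_le_trans ltr01).
(* The threshold of the lower bound; it is below 1, as the upper bound requires. *)
exists (8 * Cg)^-1; split; first by rewrite invr_gt0 mulr_gt0.
move=> n alpha alpha0 _ _; have [Q [z [Q0 zQ]]] := finite_net R n.
set C1 := (8 * Cg) `^ beta^-1.
set C2 := 2 * Q%:R * (1 + 2 * \sum_(j < Q) enorm (z j)) * (Cg^-1 `^ alpha^-1)^-1.
have C10 : 0 < C1 by rewrite powR_gt0// mulr_gt0.
have C20 : 0 <= C2.
  rewrite !mulr_ge0 ?invr_ge0 ?powR_ge0// addr_ge0// mulr_ge0// sumr_ge0// => j _.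
  exact: enorm_ge0.
(* The sum dominates both constants, and [C1] makes it positive. *)
exists (C1 + C2); split; first exact: ltr_wpDr.
move=> gamma gammaH r r0 r_small; split.
  apply: le_trans (Lambda_ge _ _ _ _ _ _ _ beta0 Cg1 gammaH r0 r_small).
  by rewrite lee_fin ler_wpM2r ?powR_ge0// lef_pV2 ?posrE ?lerDl// ltr_wpDr.
have r1 : r <= 1.
  by rewrite (le_trans (ltW r_small))// invf_le1 ?mulr_gt0//; lra.
apply: le_trans (Lambda_le _ _ _ _ _ _ _ _ _ alpha0 Cg1 gammaH Q0 zQ r0 r1) _.
by rewrite lee_fin ler_wpM2r ?powR_ge0// lerDr ltW.
Qed.
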